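(* Let $0\le r\le n$ and let $\mathcal{G}(n,r)$ be the $\mathbb{Q}$-vector space of formal linear combinations of the symbols $[\underline{r}]$, where $\underline{r}$ ranges over all length-$n$ $(0,1)$-sequences with exactly $r$ ones. Then the $\mathcal{G}$-invariants $\mathcal{G}(F(\underline{r}))$ of the freedom matroids $F(\underline{r})$, as $\underline{r}$ ranges over all length-$n$ $(0,1)$-sequences with exactly $r$ ones, form a basis of $\mathcal{G}(n,r)$.
   Context: For a rank-$r$ matroid $M$ on $\{1,\ldots,n\}$ and a permutation $\pi$ of $\{1,\ldots,n\}$, the rank sequence $\underline{r}(\pi)=(r_1,\ldots,r_n)$ is given by $r_1=r(\{\pi(1)\})$ and $r_j=r(\{\pi(1),\ldots,\pi(j)\})-r(\{\pi(1),\ldots,\pi(j-1)\})$ for $j\ge2$ (a $(0,1)$-sequence with $r$ ones). The symbols $[\underline{r}]$ are linearly independent formal symbols, and the $\mathcal{G}$-invariant is $\mathcal{G}(M)=\sum_\pi[\underline{r}(\pi)]$ over all $n!$ permutations; thus $\mathcal{G}(M)\in\mathcal{G}(n,r)$. For a length-$n$ $(0,1)$-sequence $\underline{r}$ with ones in positions $b_1<b_2<\cdots<b_r$, the freedom matroid $F(\underline{r})$ is the rank-$r$ matroid on $\{1,\ldots,n\}$ in which $1,\ldots,b_1-1$ are loops; for $1\le j\le r-1$, $b_j$ is added as an isthmus and $b_j+1,\ldots,b_{j+1}-1$ are added freely (in general position) in the flat $\mathrm{cl}(\{b_1,\ldots,b_j\})$; and $b_r,b_r+1,\ldots,n$ are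 added freely in the whole matroid. Equivalently, $S\subseteq\{1,\ldots,n\}$ is independent in $F(\underline{r})$ iff $|S\cap\{1,\ldots,i\}|\le r_1+\cdots+r_i$ for every $i$. *)

(* Defs.v *)
From HB Require Import structures.
From mathcomp Require Import all_boot all_order all_fingroup all_algebra.
From mathcomp Require Import zify.

Set Implicit Arguments.
Unset Strict Implicit.
Unset Printing Implicit Defensive.

Import GRing.Theory.
Local Open Scope nat_scope.

Section SetSystems.
Variable T : finType.
Implicit Types (E S X : {set T}) (I : {set {set T}}) (e : T).

Definition rank I S : nat := \max_(A in I | A \subset S) #|A|.

Definition mclosure E I S : {set T} :=
  [set x in E | rank I (x |: S) == rank I S].

Definition add_isthmus e I : {set {set T}} :=
  I :|: [set e |: A | A in I].

(* Principal extension: e is placed in general position on the flat X of the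
   matroid on E with independent sets I, so e |: A is independent iff A is and
   cl(A) does not contain X.  In particular e is a loop if X = cl(set0). *)
Definition add_freely E X e I : {set {set T}} :=
  I :|: [set e |: A | A in I & ~~ (X \subset mclosure E I A)].

End SetSystems.

Record matroid (T : finType) := Matroid {
  indep :> {set {set T}};
  indep0 : set0 \in indep;
  indep_sub : forall A B : {set T},
    A \subset B -> B \in indep -> A \in indep;
  indep_aug : forall A B : {set T},
    A \in indep -> B \in indep -> #|A| < #|B| ->
    exists2 x, x \in B :\: A & x |: A \in indep
}.

Section Freedom.
Variables (n : nat) (t : n.-tuple bool).
Implicit Types (A B S : {set 'I_n}) (k : nat).

(* [below k] is the set of elements already present when k is added, and
   [ones_below k] the set of those b_j that are among them.  Before the first
   b_j, the flat is cl(set0) and k is added as a loop. *)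
Definition below (k : nat) : {set 'I_n} := [set i : 'I_n | i < k].
Definition ones_below (k : nat) : {set 'I_n} := [set i in below k | tnth t i].

Definition freedom_step (I : {set {set 'I_n}}) (k : 'I_n) : {set {set 'I_n}} :=
  if tnth t k then add_isthmus k I
  else add_freely (below k) (mclosure (below k) I (ones_below k)) k I.

Definition freedom_indep : {set {set 'I_n}} :=
  foldl freedom_step [set set0] (enum 'I_n).

(* Closed form of the family after the first k steps; see [fam_step]. *)
Definition fam (k : nat) : {set {set 'I_n}} :=
  [set A : {set 'I_n} | (A \subset below k) &&
    [forall i : 'I_k.+1, #|A :&: below i| <= #|ones_below i|]].

Lemma famP k A : reflect (A \subset below k /\
   forall i, i <= k -> #|A :&: below i| <= #|ones_below i|) (A \in fam k).
Proof.
rewrite inE; apply: (iffP andP) => [[-> /forallP H]|[-> H]]; split=> //.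
  by move=> i ik; apply: (H (Ordinal (n := k.+1) (m := i) _)).
by apply/forallP=> i; apply: H; rewrite -ltnS.
Qed.

Lemma below0 : below 0 = set0.
Proof. by apply/setP=> i; rewrite !inE. Qed.

Lemma belowS (k : 'I_n) : below k.+1 = k |: below k.
Proof. by apply/setP=> i; rewrite !inE ltnS leq_eqVlt -val_eqE. Qed.

Lemma ones_sub i : ones_below i \subset below i.
Proof. by apply/subsetP=> x; rewrite inE => /andP[]. Qed.

Lemma below_mono i j : i <= j -> below i \subset below j.
Proof. by move=> ij; apply/subsetP=> x; rewrite !inE => /leq_trans; apply. Qed.

Lemma onesI k i : i <= k -> ones_below k :&: below i = ones_below i.
Proof. 
move=> ik; apply/setP=> x; rewrite !inE.
case: (ltnP x i) => xi; last by rewrite !andbF.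
by rewrite (leq_trans xi ik) andbT.
Qed.

Lemma fam0 k : set0 \in fam k.
Proof. by apply/famP; rewrite sub0set; split=> // i _; rewrite set0I cards0. Qed.

Lemma fam_sub k A B : A \subset B -> B \in fam k -> A \in fam k.
Proof.
move=> AB /famP[Bk HB]; apply/famP; split; first exact: subset_trans Bk.
by move=> i ik; apply: leq_trans (HB i ik); apply/subset_leq_card/setSI.
Qed.

Lemma fam_ones k : ones_below k \in fam k.
Proof.
apply/famP; split; first exact: ones_sub.
by move=> i ik; rewrite onesI.
Qed.

Lemma fam_aug k A B : A \in fam k -> B \in fam k -> #|A| < #|B| ->
  exists2 x, x \in B :\: A & x |: A \in fam k.
Proof.
move=> /famP[Ak HA] /famP[Bk HB] ltAB.
pose tight i := (i <= k) && (#|A :&: below i| == #|ones_below i|).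
have t0 : tight 0.
  rewrite /tight /= below0 setI0 cards0 eq_sym cards_eq0 -subset0 -below0.
  exact: ones_sub.
have tb i : tight i -> i <= k by case/andP.
case: (ex_maxnP (ex_intro _ 0 t0) tb) => i /andP[ik /eqP ti] imax.
have : ~~ (B :\: below i \subset A :\: below i).
  apply/negP=> /subset_leq_card.
  have := HB i ik; rewrite -ti.
  rewrite -(cardsID (below i) A) -(cardsID (below i) B) in ltAB; lia.
case/subsetPn=> x; rewrite !inE => /andP[xi xB]; rewrite xi /= => xA.
exists x; first by rewrite !inE xA xB.
apply/famP; split.
  by rewrite subUset sub1set Ak (subsetP Bk).
move=> j jk; rewrite setIUl; case: (ltnP x j) => xj; last first.
  suff -> : [set x] :&: below j = set0 by rewrite set0U; exact: HA.
  apply/setP=> y; rewrite !inE; apply/negP=> /andP[/eqP->]; lia.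
have nt : ~~ tight j by apply/negP=> /imax; lia.
rewrite /tight jk /= in nt; have := HA j jk.
have [+ _] := leq_card_setU ([set x] :&: below j) (A :&: below j).
have : #|[set x] :&: below j| <= 1.
  by rewrite -(cards1 x) subset_leq_card ?subsetIl.
move=> c1 cU cA; apply: leq_trans cU _; apply: leq_trans (leq_add c1 (leqnn _)) _.
by rewrite add1n ltn_neqAle nt.
Qed.

Lemma fam_card k A : A \in fam k -> #|A| <= #|ones_below k|.
Proof. by case/famP=> /setIidPl AE H; rewrite -AE; apply: H. Qed.

Lemma rank_indep (U : finType) (I : {set {set U}}) (A : {set U}) :
  A \in I -> rank I A = #|A|.
Proof.
move=> AI; apply/eqP; rewrite eqn_leq; apply/andP; split.
  by apply/bigmax_leqP=> B /andP[_ /subset_leq_card].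
by apply: (leq_bigmax_cond (F := fun B : {set U} => #|B|)); rewrite AI subxx.
Qed.

Lemma ge_rank (U : finType) (I : {set {set U}}) (A S : {set U}) :
  A \in I -> A \subset S -> #|A| <= rank I S.
Proof.
by move=> AI AS; apply: (leq_bigmax_cond (F := fun B : {set U} => #|B|)); rewrite AI.
Qed.

Lemma fam_rank_le k S : rank (fam k) S <= #|ones_below k|.
Proof. by apply/bigmax_leqP=> B /andP[/fam_card]. Qed.

Lemma fam_free k A : A \in fam k ->
  ~~ (mclosure (below k) (fam k) (ones_below k) \subset mclosure (below k) (fam k) A)
  = (#|A| < #|ones_below k|).
Proof.
move=> AF; case: (ltnP #|A| #|ones_below k|) => h.
  have [x] := fam_aug AF (fam_ones k) h.
  rewrite inE => /andP[xA xo] xAF; apply/subsetPn; exists x.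
    have xb := subsetP (ones_sub k) x xo.
    rewrite inE xb /=.
    suff -> : x |: ones_below k = ones_below k by [].
    by apply/setUidPr; rewrite sub1set.
  by rewrite inE negb_and (rank_indep xAF) (rank_indep AF) cardsU1 xA; lia.
apply/negbF/subsetP=> x; rewrite !inE => /andP[-> _] /=.
have := fam_rank_le k (x |: A); have := ge_rank AF (subsetUr [set x] A).
rewrite (rank_indep AF); lia.
Qed.

Lemma onesS (k : 'I_n) :
  #|ones_below k.+1| = #|ones_below k| + tnth t k.
Proof.
rewrite /ones_below belowS.
case tk: (tnth t k).
  have -> : [set i in k |: below k | tnth t i] = k |: [set i in below k | tnth t i].
    by apply/setP=> i; rewrite !inE; case: eqVneq => // ->; rewrite tk.
  by rewrite cardsU1 !inE ltnn addnC.
have -> : [set i in k |: below k | tnth t i] = [set i in below k | tnth t i].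
  by apply/setP=> i; rewrite !inE; case: eqVneq => //= ->; rewrite tk andbF.
by rewrite addn0.
Qed.

Lemma famS_old (k : 'I_n) A : k \notin A -> (A \in fam k.+1) = (A \in fam k).
Proof.
move=> kA; apply/famP/famP => [[sA H]|[sA H]]; split.
- apply/subsetP=> x xA; have := subsetP sA x xA; rewrite belowS !inE.
  by case: eqVneq => // xk; rewrite -xk xA in kA.
- by move=> i ik; apply: H; lia.
- by apply: subset_trans sA _; apply: below_mono.
move=> i; rewrite leq_eqVlt => /orP[/eqP->|/H//].
rewrite onesS; have := H k (leqnn _).
have -> : A :&: below k.+1 = A :&: below k; last by lia.
rewrite belowS setIUr; suff -> : A :&: [set k] = set0 by rewrite set0U.
by apply/setP=> x; rewrite !inE; apply/negP=> /andP[xA /eqP xk]; rewrite -xk xA in kA.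
Qed.

Lemma famS_new (k : 'I_n) A : k \notin A ->
  (k |: A \in fam k.+1) = (A \in fam k) && (#|A| < #|ones_below k.+1|).
Proof.
move=> kA; apply/idP/andP => [kAF|[AF ltA]].
  split; first by rewrite -famS_old //; apply: fam_sub kAF; apply: subsetUr.
  by have := fam_card kAF; rewrite cardsU1 kA.
have /famP[sA H] := AF; apply/famP; split.
  by rewrite belowS setUS.
move=> i; rewrite leq_eqVlt => /orP[/eqP->|].
  apply: leq_trans (subset_leq_card (subsetIl (k |: A) (below k.+1))) _.
  by rewrite cardsU1 kA.
rewrite ltnS => ik; rewrite setIUl.
suff -> : [set k] :&: below i = set0 by rewrite set0U; apply: H.
by apply/setP=> x; rewrite !inE; apply/negP=> /andP[/eqP->]; lia.
Qed.

Lemma fam_notin (k : 'I_n) A : A \in fam k -> k \notin A.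
Proof. by case/famP=> sA _; apply/negP=> /(subsetP sA); rewrite inE ltnn. Qed.

Lemma fam_step (k : 'I_n) : freedom_step (fam k) k = fam k.+1.
Proof.
have E : freedom_step (fam k) k =
  fam k :|: [set k |: A | A in fam k & #|A| < #|ones_below k.+1|].
  rewrite /freedom_step /add_isthmus /add_freely onesS.
  case: (tnth t k); congr (_ :|: _); apply/setP=> B;
    apply/imsetP/imsetP => [] [A AF ->]; exists A => //.
  - by apply/setIdP; rewrite addn1 ltnS fam_card.
  - by case/setIdP: AF.
  - by case/setIdP: AF => AF; rewrite fam_free // => h; apply/setIdP; rewrite addn0.
  - by case/setIdP: AF => AF; rewrite addn0 -fam_free // => h; apply/setIdP.
rewrite E; apply/setP=> B; rewrite in_setU.
have [kB|kB] := boolP (k \in B); last first.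
  rewrite famS_old //; case: (B \in fam k) => //=.
  by apply/negP=> /imsetP[A _ BE]; rewrite BE setU11 in kB.
rewrite -(setD1K kB) famS_new ?setD11 //.
have -> : (k |: B :\ k \in fam k) = false.
  by apply/negP=> /fam_notin; rewrite setU11.
apply/imsetP/andP => [[A]|[BF ltB]].
  case/setIdP=> AF ltA E'.
  suff -> : B :\ k = A by [].
  by rewrite -[LHS](setU1K (a := k)) ?setD11 // E' setU1K // fam_notin.
by exists (B :\ k) => //; apply/setIdP.
Qed.

Lemma freedom_fam : freedom_indep = fam n.
Proof.
have H k : k <= n -> foldl freedom_step [set set0] (take k (enum 'I_n)) = fam k.
  elim: k => [|k IH] kn.
    rewrite take0 /=; apply/setP=> A; rewrite inE; apply/eqP/idP => [->|].
      exact: fam0.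
    by case/famP; rewrite below0 subset0 => /eqP.
  pose e := Ordinal kn.
  rewrite (take_nth e) ?size_enum_ord // foldl_rcons IH 1?ltnW //.
  have -> : nth e (enum 'I_n) k = e by apply: val_inj; rewrite /= nth_enum_ord.
  exact: (fam_step e).
by rewrite -H // take_oversize // size_enum_ord.
Qed.

Lemma ones_below_sum i : #|ones_below i| = \sum_(j < n | j < i) tnth t j.
Proof.
rewrite -sum1_card big_mkcond [RHS]big_mkcond; apply: eq_bigr => j _.
by rewrite !inE; case: (j < i); case: (tnth t j).
Qed.

Lemma freedom_indepP S : reflect
  (forall i, i <= n -> #|[set x in S | x < i]| <= \sum_(j < n | j < i) tnth t j)
  (S \in freedom_indep).
Proof.
have E i : [set x in S | x < i] = S :&: below i.
  by apply/setP=> x; rewrite !inE.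
rewrite freedom_fam; apply: (iffP (famP _ _)) => [[_ H] i ik|H].
  by rewrite E -ones_below_sum; apply: H.
split; first by apply/subsetP=> x _; rewrite inE ltn_ord.
by move=> i ik; rewrite -E ones_below_sum; apply: H.
Qed.

Lemma freedom0 : set0 \in freedom_indep.
Proof. by rewrite freedom_fam; apply: fam0. Qed.

Lemma freedom_sub A B :
  A \subset B -> B \in freedom_indep -> A \in freedom_indep.
Proof. by rewrite freedom_fam; apply: fam_sub. Qed.

Lemma freedom_aug A B :
  A \in freedom_indep -> B \in freedom_indep -> #|A| < #|B| ->
  exists2 x, x \in B :\: A & x |: A \in freedom_indep.
Proof. by rewrite freedom_fam; apply: fam_aug. Qed.

Definition freedom_matroid : matroid 'I_n :=
  Matroid freedom0 freedom_sub freedom_aug.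

Lemma freedom_rank : rank freedom_matroid setT = count id t.
Proof.
have -> : count id t = #|ones_below n|.
  rewrite ones_below_sum -sumn_count sumnE big_map big_tuple.
  by apply: eq_bigl => j; rewrite ltn_ord.
rewrite /= freedom_fam; apply/eqP; rewrite eqn_leq fam_rank_le.
exact: ge_rank (fam_ones n) (subsetT _).
Qed.

End Freedom.

Section GInvariant.
Variable n : nat.

Definition first_elts (pi : {perm 'I_n}) (j : nat) : {set 'I_n} :=
  [set pi i | i : 'I_n & i < j].

Definition rank_seq (M : matroid 'I_n) (pi : {perm 'I_n}) : n.-tuple bool :=
  [tuple rank M (first_elts pi j.+1) - rank M (first_elts pi j) == 1 | j < n].

(* The increments are 0 or 1, so encoding them as booleans loses nothing. *)
Lemma rank_seqE (M : matroid 'I_n) (pi : {perm 'I_n}) (j : 'I_n) :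
  tnth (rank_seq M pi) j =
    rank M (first_elts pi j.+1) - rank M (first_elts pi j) :> nat.
Proof.
rewrite tnth_mktuple.
suff : rank M (first_elts pi j.+1) <= (rank M (first_elts pi j)).+1 by case: eqP; lia.
apply/bigmax_leqP => A /andP[AM sA].
have -> : #|A| = (pi j \in A) + #|A :\ pi j| by rewrite (cardsD1 (pi j)).
suff : #|A :\ pi j| <= rank M (first_elts pi j) by case: (pi j \in A); lia.
apply: ge_rank; first exact: indep_sub (subD1set _ _) AM.
apply/subsetP=> x; rewrite !inE => /andP[xj /(subsetP sA)].
case/imsetP=> i; rewrite inE ltnS leq_eqVlt => /orP[/eqP ij E|ij ->].
  by rewrite E (val_inj ij) eqxx in xj.
by apply: imset_f; rewrite inE.
Qed.

Local Open Scope ring_scope.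

Definition formal_space : vectType rat := {ffun n.-tuple bool -> rat^o}.

Definition symbol (t : n.-tuple bool) : formal_space :=
  [ffun u => (u == t)%:R].

Definition G_invariant (M : matroid 'I_n) : formal_space :=
  \sum_(pi : {perm 'I_n}) symbol (rank_seq M pi).

End GInvariant.

Definition sequences (n r : nat) : {set n.-tuple bool} :=
  [set t : n.-tuple bool | count id t == r].

Definition G_space (n r : nat) : {vspace formal_space n} :=
  span [seq symbol t | t <- enum (sequences n r)].

(* Main.v *)
(** The partial sums of the rank sequence of a permutation are the ranks of its
    initial segments.  In the freedom matroid [F(t)], every [i]-set has rank at
    least [t_1 + ... + t_i], which is the rank of [{1,...,i}].  Hence all
    symbols occurring in [G(F(t))] dominate [t], and [t] itself occurs
    (identity permutation): the matrix of the G-invariants in the symbols is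
    triangular with nonzero diagonal. *)
Require Import Defs.
From mathcomp Require Import all_boot all_order all_algebra.
From mathcomp Require Import fingroup perm zify.

Set Implicit Arguments.
Unset Strict Implicit.
Unset Printing Implicit Defensive.

Import GRing.Theory.

(** Sort [s] by weight. For the head [x], every later [y] has [w x <= w y], so [v y x = 0], whereas
    [v x x] is nonzero: reading coordinate [x] shows that [v x] is outside the span of the later
    vectors. *)
Lemma triangular_free (I : finType) (K : fieldType) (w : I -> nat)
    (v : I -> {ffun I -> K^o}) (s : seq I) :
  uniq s -> (forall i, v i i != 0%R) ->
  (forall i j, v i j != 0%R -> i != j -> w i < w j) -> free (map v s).
Proof.
move=> us vii vij; pose le_w := relpre w leq.
have le_w_tr : transitive le_w by move=> y x z; apply: leq_trans.
have ps : perm_eq (map v (sort le_w s)) (map v s).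
  by apply: perm_map; rewrite perm_sort.
rewrite -(perm_free ps) {ps}.
have : uniq (sort le_w s) by rewrite sort_uniq.
have : sorted le_w (sort le_w s).
  by apply: sort_sorted => x y; apply: leq_total.
elim: (sort le_w s) => [|x e IH] /= ep; first by rewrite nil_free.
case/andP=> xe ue; rewrite free_cons IH ?(path_sorted ep) // andbT.
apply/negP=> /(coord_span (X := in_tuple (map v e)))
             /(congr1 (fun f : {ffun I -> K^o} => f x)).
rewrite sum_ffunE big1 => [/eqP|k _]; first by rewrite (negPf (vii x)).
have ke : k < size e by rewrite -(size_map v).
rewrite ffunE /=.
rewrite (nth_map x) //; set y := nth x e k.
have ye : y \in e by apply: mem_nth.
have yx : y != x by apply: contraNneq xe => <-.
have wxy : w x <= w y by have /allP/(_ y ye) := order_path_min le_w_tr ep.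
by have [->|/vij/(_ yx)] := eqVneq (v y x) 0%R; [rewrite scaler0 | lia].
Qed.

Section RankSequences.
Variable n : nat.
Implicit Types (s t : n.-tuple bool) (S : {set 'I_n}) (pi : {perm 'I_n}).

Lemma rank_mono (T : finType) (J : {set {set T}}) (S S' : {set T}) :
  S \subset S' -> rank J S <= rank J S'.
Proof.
move=> sSS; apply/bigmax_leqP=> A /andP[AJ AS].
exact: ge_rank AJ (subset_trans AS sSS).
Qed.

Lemma count_ones t : count id t = #|ones_below t n|.
Proof.
rewrite ones_below_sum -sumn_count sumnE big_map big_tuple.
by apply: eq_bigl => j; rewrite ltn_ord.
Qed.

Lemma ones_below_inj s t :
  (forall i, i <= n -> #|ones_below s i| = #|ones_below t i|) -> s = t.
Proof.
move=> E; apply: eq_from_tnth => i; have := E i.+1 (ltn_ord i).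
by rewrite !onesS E 1?ltnW //; case: (tnth s i); case: (tnth t i); lia.
Qed.

Lemma ones_below_rank_seq (M : matroid 'I_n) pi i : i <= n ->
  #|ones_below (rank_seq M pi) i| = rank M (first_elts pi i).
Proof.
elim: i => [|i IH] lin.
  have -> : first_elts pi 0 = set0.
    by apply/setP=> x; rewrite in_set0; apply/negP=> /imsetP[y]; rewrite inE.
  rewrite (rank_indep (indep0 M)) cards0; apply: eq_card0 => x.
  by rewrite !inE.
(* The sum telescopes; the truncated subtraction is exact because rank is monotone. *)
rewrite (onesS _ (Ordinal lin)) rank_seqE IH 1?ltnW //= subnKC //.
apply: rank_mono; apply: imsetS; apply/subsetP=> x; rewrite !inE; lia.
Qed.

Lemma card_below i : i <= n -> #|below n i| = i.
Proof.
move=> lin; rewrite -sum1_card -[RHS](card_ord i) -sum1_card.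
rewrite (big_ord_widen n (fun=> 1) lin).
by apply: eq_bigl => j; rewrite inE.
Qed.

Lemma card_first_elts pi i : i <= n -> #|first_elts pi i| = i.
Proof. by move=> lin; rewrite card_imset ?card_below //; apply: perm_inj. Qed.

Lemma ones_below_mono t i j : i <= j -> #|ones_below t i| <= #|ones_below t j|.
Proof. by move=> ij; rewrite -(onesI t ij) subset_leq_card ?subsetIl. Qed.

(* Greedy choice: the largest element of [S] is at least [#|S|.-1] (indices
   start at 0), so it may be added exactly when position [#|S|.-1] carries a
   one. *)
Lemma fam_large_subset t i S : #|S| = i ->
  exists A : {set 'I_n},
    [/\ A \subset S, A \in fam t n & #|A| = #|ones_below t i|].
Proof.
elim: i S => [|i IH] S cS.
  exists set0; rewrite sub0set fam0 cards0; split=> //.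
  by apply/esym/eq_card0 => x; rewrite !inE.
have /card_gt0P[x0 x0S] : 0 < #|S| by rewrite cS.
case: (@arg_maxnP _ x0 [in S] (@nat_of_ord n) x0S) => m /= mS mmax.
have /IH[A [AS AF cA]] : #|S :\ m| = i.
  by move: cS; rewrite (cardsD1 m) mS; lia.
have im : i <= m.
  suff : #|S| <= #|below n m.+1|.
    by rewrite cS card_below.
  by apply/subset_leq_card/subsetP=> x /mmax; rewrite inE ltnS.
have lin : i < n by apply: leq_ltn_trans (ltn_ord m).
have cE := onesS t (Ordinal lin); rewrite /= in cE.
case ti: (tnth t (Ordinal lin)) cE => cE; last first.
  exists A; rewrite AF cA cE addn0; split=> //.
  by apply: subset_trans AS (subD1set _ _).
have mA : m \notin A by apply/negP=> /(subsetP AS); rewrite !inE eqxx.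
have cmA : #|m |: A| = #|ones_below t i.+1| by rewrite cardsU1 mA cA cE addnC.
exists (m |: A); split=> //.
  by rewrite subUset sub1set mS (subset_trans AS (subD1set _ _)).
case/famP: AF => _ HA; apply/famP; split.
  by apply/subsetP=> x _; rewrite inE.
(* If [m < k], then [i.+1 <= k], so the size of all of [m |: A] is already within the bound.
   Otherwise [m] lies outside [below n k], and the bound for [A] applies. *)
move=> k kn; case: (ltnP m k) => mk.
  apply: leq_trans (subset_leq_card (subsetIl _ _)) _.
  by rewrite cmA ones_below_mono //; lia.
rewrite setIUl (_ : [set m] :&: below n k = set0) ?set0U; first exact: HA.
by apply/setP=> x; rewrite !inE; apply/negP=> /andP[/eqP->]; lia.
Qed.

(** The first [i] values of [pi] form an [i]-set, so [fam_large_subset] supplies an independent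
    subset of the required size. *)
Lemma rank_seq_freedom_ge t pi i : i <= n ->
  #|ones_below t i| <= #|ones_below (rank_seq (freedom_matroid t) pi) i|.
Proof.
move=> lin; rewrite ones_below_rank_seq //.
have [A [AS AF <-]] := fam_large_subset t (card_first_elts pi lin).
by apply: ge_rank AS; rewrite /= freedom_fam.
Qed.

(** For the identity, the initial segments are the sets [below n i], on which the constraints
    defining [fam] cap the rank from above; dominance gives the other inequality. *)
Lemma rank_seq_freedom1 t : rank_seq (freedom_matroid t) 1 = t.
Proof.
apply: ones_below_inj => i lin; apply/eqP.
rewrite eqn_leq rank_seq_freedom_ge // andbT ones_below_rank_seq //.
apply/bigmax_leqP=> A /andP[] /=; rewrite freedom_fam => /famP[_ HA] sA.
suff /setIidPl AE : A \subset below n i by rewrite -AE HA.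
by apply/subsetP=> x /(subsetP sA)/imsetP[y]; rewrite !inE perm1 => yi ->.
Qed.

(** This keeps every symbol of a G-invariant among the sequences with a fixed number of ones. *)
Lemma count_rank_seq (M : matroid 'I_n) pi :
  count id (rank_seq M pi) = rank M setT.
Proof.
rewrite count_ones ones_below_rank_seq //; congr (rank _ _).
by apply/eqP; rewrite eqEcard subsetT cardsT card_ord card_first_elts ?leqnn.
Qed.

(** A strictly increasing map from the dominance order to [nat], as [triangular_free] requires. *)
Definition dominance_weight t := \sum_(i < n.+1) #|ones_below t i|.

Lemma dominance_weight_lt s t : s != t ->
  (forall i, i <= n -> #|ones_below s i| <= #|ones_below t i|) ->
  dominance_weight s < dominance_weight t.
Proof.
move=> neq dom; rewrite /dominance_weight.
have le_i (i : 'I_n.+1) : true ->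
    #|ones_below s i| <= #|ones_below t i|
      ?= iff (#|ones_below s i| == #|ones_below t i|).
  by move=> _; split=> //; apply: dom; rewrite -ltnS.
(* Equal totals would force equality of all partial sums, hence [s = t]. *)
have [le_w eq_w] := leqif_sum le_i.
rewrite ltn_neqAle le_w andbT eq_w; apply: contra neq => /forallP E.
apply/eqP/ones_below_inj => i lin.
by apply/eqP; apply: (E (Ordinal (n := n.+1) (m := i) _)).
Qed.

Local Open Scope ring_scope.

(** Since the scalars have characteristic zero, a coefficient is nonzero exactly when some
    permutation realizes [t]. *)
Lemma G_invariant_coef (M : matroid 'I_n) t :
  G_invariant M t = (#|[set pi | rank_seq M pi == t]|)%:R.
Proof.
rewrite /G_invariant sum_ffunE -sum1_card natr_sum.
rewrite [RHS]big_mkcond; apply: eq_bigr => pi _.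
by rewrite ffunE inE eq_sym; case: eqP.
Qed.

End RankSequences.

Theorem mainTheorem9 (n r : nat) (hr : (r <= n)%N) :
  basis_of (G_space n r)
    [seq G_invariant (freedom_matroid t) | t <- enum (sequences n r)].
Proof.
rewrite basisEfree; apply/and3P; split.
- apply: (@triangular_free _ _ (@dominance_weight n)); first exact: enum_uniq.
  + move=> t; rewrite G_invariant_coef Num.Theory.pnatr_eq0 -lt0n.
    by apply/card_gt0P; exists 1%g; rewrite inE rank_seq_freedom1.
  + move=> t s; rewrite G_invariant_coef Num.Theory.pnatr_eq0 -lt0n.
    case/card_gt0P=> pi; rewrite inE => /eqP <- neq.
    by apply: dominance_weight_lt neq _ => i; apply: rank_seq_freedom_ge.
- apply/span_subvP=> _ /mapP[t tr ->]; apply: memv_suml => pi _.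
  apply/memv_span/map_f; move: tr.
  by rewrite !mem_enum !inE count_rank_seq freedom_rank.
(* The spanning symbols and the invariants are indexed by the same list, so the dimension is at most
   the number of invariants. *)
- by rewrite size_map; apply: leq_trans (dim_span _) _; rewrite size_map.
Qed.
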